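(* Let $A$ be a finite-dimensional complex semisimple algebra and let $S:A\to A$ be an involutive algebra anti-automorphism. Suppose that $A$ has no $2\times 2$ matrix summand (i.e. in the decomposition of $A$ as a direct sum of full matrix algebras over $\mathbb C$, no summand is isomorphic to $M_2(\mathbb C)$). Then there exists $a\in A$ such that $a$ and $Sa$ generate $A$ as an algebra.
   Context: Algebra anti-automorphisms are $\mathbb C$-linear: $S$ is a $\mathbb C$-linear bijection with $S(xy)=S(y)S(x)$; involutive means $S\circ S=\mathrm{id}$. $Sa$ denotes $S(a)$. The algebra generated by a set of elements is the linear span of all non-empty words in those elements. *)

(* Defs.v *)
From HB Require Import structures.
From mathcomp Require Import all_boot all_order all_algebra all_field.
From mathcomp Require Import reals complex.
Set Implicit Arguments.
Unset Strict Implicit.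
Unset Printing Implicit Defensive.
Import Order.TTheory GRing.Theory Num.Theory.
Local Open Scope ring_scope.

Definition left_ideal (K : fieldType) (A : falgType K) (I : {vspace A}) : Prop :=
  (fullv * I <= I)%VS.

(* The left regular module is semisimple: every submodule is a direct summand.
   Left ideals of the unital algebra A are automatically subspaces. *)
Definition semisimple_alg (K : fieldType) (A : falgType K) : Prop :=
  forall I : {vspace A}, left_ideal I ->
    exists J : {vspace A},
      [/\ left_ideal J, (I + J)%VS = fullv & (I :&: J)%VS = 0%VS].

(* The family phi is an algebra isomorphism from A onto the direct sum of the
   matrix algebras M_{n_i + 1}(K), i < r. Sizes are successors because 'M_m is
   a (nontrivial unital) algebra in the library only for m of the form n.+1. *)
Definition matrix_decomposition (K : fieldType) (A : falgType K) (r : nat)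
    (n : 'I_r -> nat) (phi : forall i : 'I_r, {lrmorphism A -> 'M[K]_((n i).+1)})
    : Prop :=
  bijective (fun x : A =>
    [ffun i : 'I_r => phi i x] : {dffun forall i : 'I_r, 'M[K]_((n i).+1)}).

Definition no_M2_summand (K : fieldType) (A : falgType K) : Prop :=
  forall (r : nat) (n : 'I_r -> nat)
         (phi : forall i : 'I_r, {lrmorphism A -> 'M[K]_((n i).+1)}),
    matrix_decomposition phi -> forall i : 'I_r, (n i).+1 <> 2%N.

Definition alg_anti_automorphism (K : fieldType) (A : falgType K)
    (S : {linear A -> A}) : Prop :=
  bijective S /\ forall x y : A, S (x * y) = S y * S x.

(* Words are nonempty, so the generated algebra need not contain 1 a priori;
   this is why agenv (which adjoins 1) is not used. *)
Definition generates_alg (K : fieldType) (A : falgType K) (X : seq A) : Prop :=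
  forall x : A, exists2 ws : seq (seq A),
    all (fun w => (w != [::]) && all (mem X) w) ws &
    x \in <<[seq \prod_(y <- w) y | w <- ws]>>%VS.

(* Main.v *)
(* Call an idempotent e primitive if eAe = Ke, and two primitive idempotents
   linked if eAf <> 0, i.e. if they lie in the same matrix summand. One can
   write 1 as a sum of orthogonal primitive idempotents e permuted by S such
   that either Se = e, or e and Se are orthogonal and S acts as -1 on eA(Se);
   the first kind (set O) is never linked to the second (set F). Choose weights
   l(e), distinct and nonzero, with l(Se) = - l(e) on F, and elements xF = SxF
   supported on F and xO = - SxO supported on O whose components in eAf are
   nonzero for all linked e, f with f <> Se. Put
     s = (sum of l(e) e over O) + xF,   k = (sum of l(e) e over F) + xO,
   so that Ss = s, Sk = - k, and a := s + k, Sa = s - k generate s and k. If the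
   l(e) on O, resp. F, avoid the eigenvalues of xF, resp. xO, polynomials in s
   and k without constant term yield every e, hence every line eAf with f <> Se.
   The remaining lines eA(Se) are products (eAg)(gA(Se)) as soon as the block
   of e contains a third idempotent g, i.e. unless it is a 2 x 2 matrix algebra.
*)
Require Import Defs.
From HB Require Import structures.
From mathcomp Require Import all_boot all_order all_algebra all_field.
From mathcomp Require Import boolp.
From mathcomp Require Import reals complex.
Set Implicit Arguments.
Unset Strict Implicit.
Unset Printing Implicit Defensive.
Import Order.TTheory GRing.Theory Num.Theory.
Local Open Scope ring_scope.

(** * Primitive idempotents *)

Section RegularAlgebra.
Variables (K : numClosedFieldType) (A : falgType K).
Implicit Types (a b e f g p q u v w x y : A).

(** Von Neumann regularity, the form in which semisimplicity is used below. *)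
Definition regular_alg : Prop := forall x, exists y, x * y * x = x.

(** Let J be a complement of the left ideal Ax and write 1 = yx + f with f in J. Then xyx - x = - xf
    lies in both Ax and J, hence is zero. *)
Lemma semisimple_regular : semisimple_alg A -> regular_alg.
Proof.
move=> ssA x.
have [|J [JI IJ1 IJ0]] := ssA (fullv * <[x]>)%VS.
  by rewrite /left_ideal prodvA prodvSl ?subvf.
have : 1 \in (fullv * <[x]> + J)%VS by rewrite IJ1 memvf.
case/memv_addP=> e + [f Jf def1]; rewrite -limg_amulr.
case/memv_imgP=> y _; rewrite lfunE /= => def_e; exists y.
apply/eqP; rewrite -subr_eq0 -memv0 -IJ0 memv_cap; apply/andP; split.
  rewrite -limg_amulr; apply/memv_imgP; exists (x * y - 1); first exact: memvf.
  by rewrite lfunE /= mulrBl mul1r.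
rewrite -opprB rpredN -[X in X - _]mulr1 def1 def_e mulrDr mulrA addrAC subrr.
by rewrite add0r (subvP JI) // memv_mul ?memvf.
Qed.

Lemma horner_algZ x (c : K) (r : {poly K}) :
  horner_alg x (c *: r) = c *: horner_alg x r.
Proof. by rewrite -mul_polyC rmorphM /= horner_algC mulr_algl. Qed.

(** Polynomials of degree at most dim A form a space of dimension dim A + 1, so evaluation at [x]
    has a nonzero kernel. *)
Lemma annihilating_poly x : exists2 p : {poly K}, p != 0 & horner_alg x p = 0.
Proof.
have g_lin : linear (fun c : 'rV[K]_(dim A).+1 => horner_alg x (rVpoly c)).
  by move=> c u v; rewrite linearP rmorphD /= horner_algZ.
pose g : {linear 'rV[K]_(dim A).+1 -> A} :=
  HB.pack (fun c : 'rV[K]_(dim A).+1 => horner_alg x (rVpoly c))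
    (GRing.isLinear.Build K _ A _ _ g_lin).
pose phi := linfun g.
have ker_phi : lker phi != 0%VS.
  rewrite -dimv_eq0 -lt0n -(ltn_add2r (\dim (limg phi))) add0n.
  have := limg_ker_dim phi fullv; rewrite capfv => ->.
  by rewrite dimvf dim_matrix mul1r ltnS (leq_trans (dimvS (subvf _))) ?dimvf.
exists (rVpoly (vpick (lker phi))).
  apply: contraNneq ker_phi => c0; rewrite -vpick0.
  by rewrite -[vpick _]rVpolyK c0 linear0.
by have := memv_pick (lker phi); rewrite memv_ker (lfunE g) => /eqP.
Qed.

Definition primitive e : Prop :=
  [/\ e * e = e, e != 0 & forall x, exists c, e * x * e = c *: e].

(** The Peirce corner pAp; its dimension is the induction measure for splitting off idempotents. *)
Definition corner p : {vspace A} := limg (amull p \o amulr p)%VF.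

Lemma cornerP p x : p * p = p -> reflect (p * x * p = x) (x \in corner p).
Proof.
move=> pp; apply: (iffP memv_imgP) => [[y _ ->]|<-].
  by rewrite lfunE /= !lfunE /= -!mulrA pp !mulrA pp.
by exists x; rewrite ?memvf // lfunE /= !lfunE /= mulrA.
Qed.

(** Here pq = q = qp, so qAq lies in pAp; were the dimensions equal, [p] would lie in qAq and p =
    qpq = q. *)
Lemma corner_dim_lt p q : p * p = p -> q * q = q -> p * q * p = q -> q != p ->
  (\dim (corner q) < \dim (corner p))%N.
Proof.
move=> pp qq pq q_neq_p.
have pql : p * q = q by rewrite -pq !mulrA pp.
have pqr : q * p = q by rewrite -pq -!mulrA pp.
have sub : (corner q <= corner p)%VS.
  apply/subvP=> x /(cornerP _ qq) xE; apply/cornerP => //.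
  by rewrite -xE !mulrA pql -!mulrA pqr.
rewrite ltn_neqAle dimvS // andbT; apply: contraNneq q_neq_p => eq_dim.
have /eqP eqC : corner q == corner p by rewrite eqEdim sub eq_dim /=.
have : p \in corner q by rewrite eqC; apply/cornerP; rewrite ?pp.
by move/(cornerP _ qq); rewrite pqr qq => ->.
Qed.

Hypothesis regA : regular_alg.

(** Shrink [e] until eAe contains no other nonzero idempotent. By regularity eAe is then a division
    algebra, and a finite-dimensional one over an algebraically closed field is the field itself. *)
Lemma primitive_below e : e * e = e -> e != 0 ->
  exists2 f, primitive f & e * f * e = f.
Proof.
have [n] := ubnP (\dim (corner e)); elim: n e => // n IHn e le_n ee e_neq0.
have [[g [gg eg g_neq0 g_neq_e]]|no_g] :=
    pselect (exists g, [/\ g * g = g, e * g * e = g, g != 0 & g != e]).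
  have [|f fP fg] := IHn g _ gg g_neq0.
    by rewrite (leq_trans (corner_dim_lt ee gg eg g_neq_e)) // -ltnS.
  exists f => //; have eg1 : e * g = g by rewrite -eg !mulrA ee.
  have ge1 : g * e = g by rewrite -eg -!mulrA ee.
  by rewrite -fg !mulrA eg1 -!mulrA ge1.
(* If xyx = x then (ey)x is a nonzero idempotent of eAe, hence equal to [e] by minimality. *)
have inv x : e * x = x -> x * e = x -> x != 0 -> exists y, y * x = e.
  move=> ex xe x_neq0; have [y xyx] := regA x; exists (e * y).
  apply/eqP; apply: contra_notT no_g => neq_e.
  exists (e * y * x); split=> //.
  - by rewrite -!mulrA; congr (e * (y * _)); rewrite mulrA xe mulrA.
  - by rewrite -!mulrA xe !mulrA ee.
  - have xE : x * (e * y * x) = x by rewrite !mulrA xe xyx.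
    by apply: contraNneq x_neq0 => yx0; rewrite -xE yx0 mulr0.
exists e; last by rewrite !ee.
split=> // x; set w := e * x * e.
have [p p_neq0 pw0] := annihilating_poly w.
have [r def_p] := closed_field_poly_normal p.
have ew : e * w = w by rewrite /w !mulrA ee.
have we : w * e = w by rewrite /w -!mulrA ee.
(* Were [w] no multiple of [e], every w - ze would be left invertible in eAe, so no product of
   linear factors could vanish at [w], against p(w) = 0. *)
have [//|now] := pselect (exists c, w = c *: e).
suff : e * horner_alg w (\prod_(z <- r) ('X - z%:P)) != 0.
  move: pw0; rewrite def_p horner_algZ => /eqP.
  by rewrite scaler_eq0 lead_coef_eq0 (negPf p_neq0) /= => /eqP->;
    rewrite mulr0 eqxx.
elim: r {def_p} => [|z r IHr]; first by rewrite big_nil rmorph1 mulr1.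
rewrite big_cons rmorphM rmorphB /= horner_algX horner_algC mulrA mulrBr ew.
rewrite -scalerAr mulr1.
have [|||y yw] := inv (w - z *: e).
- by rewrite mulrBr ew -scalerAr ee.
- by rewrite mulrBl we -scalerAl ee.
- by rewrite subr_eq0; apply: contra_notN now => /eqP wE; exists z.
apply: contraNneq IHr => /(congr1 ( *%R y)).
by rewrite mulr0 mulrA yw => ->.
Qed.

(** For xyx = x put z = fye. Then xz is a multiple of [e] and zx one of [f], and xzx = x with x
    nonzero forces both scalars to be 1. *)
Lemma primitive_inv e f x : primitive e -> primitive f ->
  e * x * f = x -> x != 0 -> exists y, [/\ f * y * e = y, x * y = e & y * x =
    f].
Proof.
move=> [ee _ eP] [ff _ fP] exf x_neq0; have [y xyx] := regA x.
have ex : e * x = x by rewrite -exf !mulrA ee.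
have xf : x * f = x by rewrite -exf -!mulrA ff.
pose z := f * y * e.
have fze : f * z * e = z by rewrite /z !mulrA ff -!mulrA ee.
have xzx : x * z * x = x by rewrite /z !mulrA xf -!mulrA ex mulrA.
have [c cE] := eP (x * z); have [d dE] := fP (z * x).
have exz : e * (x * z) * e = x * z by rewrite mulrA ex -mulrA /z -!mulrA ee.
have fzx : f * (z * x) * f = z * x.
  by rewrite -mulrA -[z * x * f]mulrA xf mulrA /z !mulrA ff.
exists z; split=> //.
  have c1 : c = 1.
    apply/eqP; rewrite -subr_eq0; move: x_neq0; apply: contraNT => c_neq1.
    rewrite -(inj_eq (scalerI c_neq1)) scaler0 scalerBl scale1r.
    by rewrite -[X in c *: X]ex scalerAl -cE exz xzx subrr.
  by rewrite -exz cE c1 scale1r.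
have d1 : d = 1.
  apply/eqP; rewrite -subr_eq0; move: x_neq0; apply: contraNT => d_neq1.
  rewrite -(inj_eq (scalerI d_neq1)) scaler0 scalerBl scale1r.
  by rewrite -[X in d *: X]xf scalerAr -dE fzx mulrA xzx subrr.
by rewrite -fzx dE d1 scale1r.
Qed.

(** Made Boolean classically, so that lists of idempotents can be filtered by it. *)
Definition linked e f : bool := `[< exists x, e * x * f != 0 >].

Lemma linkedP e f : reflect (exists x, e * x * f != 0) (linked e f).
Proof. exact: asboolP. Qed.

Lemma linked_mul_eq0 e f x y : primitive e -> primitive f ->
  e * x * f = x -> f * y = y -> x != 0 -> y != 0 -> x * y != 0.
Proof.
move=> eP fP exf fy x_neq0; have [z [_ _ zx]] := primitive_inv eP fP exf x_neq0.
by apply: contraNneq => /(congr1 ( *%R z)); rewrite mulr0 mulrA zx fy => ->.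
Qed.

(** With z inverse to [x], eyf = x(zeyf) and zeyf lies in fAf = Kf; thus eAf is a line. *)
Lemma linked_span e f x y : primitive e -> primitive f ->
  e * x * f = x -> x != 0 -> exists c, e * y * f = c *: x.
Proof.
move=> eP fP exf x_neq0; have [z [fze xz _]] := primitive_inv eP fP exf x_neq0.
have [ee _ eeP] := eP; have [ff _ ffP] := fP.
have [c cE] := ffP (z * e * y); exists c.
have xf : x * f = x by rewrite -exf -!mulrA ff.
have zE : f * z = z by rewrite -fze !mulrA ff.
by rewrite -[X in c *: X]xf scalerAr -cE !mulrA xf xz ee.
Qed.

Lemma linked_refl e : primitive e -> linked e e.
Proof. by case=> ee e_neq0 _; apply/linkedP; exists 1; rewrite mulr1 ee. Qed.

Lemma linked_sym e f : primitive e -> primitive f -> linked e f -> linked f e.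
Proof.
move=> eP fP /linkedP[x x_neq0]; have [ee e_neq0 _] := eP; have [ff _ _] := fP.
have [|y [fye xy _]] := primitive_inv eP fP _ x_neq0.
  by rewrite !mulrA ee -!mulrA ff.
apply/linkedP; exists y; rewrite fye; apply: contraNneq e_neq0 => y0.
by rewrite -xy y0 mulr0.
Qed.

Lemma linked_trans e f g : primitive e -> primitive f -> primitive g ->
  linked e f -> linked f g -> linked e g.
Proof.
move=> eP fP gP /linkedP[x x_neq0] /linkedP[y y_neq0].
have [ee _ _] := eP; have [ff _ _] := fP.
apply/linkedP; exists (x * f * y).
have -> : e * (x * f * y) * g = (e * x * f) * (f * y * g).
  by rewrite !mulrA -[in RHS](mulrA _ f f) ff.
apply: (linked_mul_eq0 eP fP) => //; first by rewrite !mulrA ee -!mulrA ff.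
by rewrite !mulrA ff.
Qed.

End RegularAlgebra.

(** * Idempotents adapted to the involution *)

Section OrthogonalSystems.
Variables (K : numClosedFieldType) (A : falgType K).
Implicit Types (a b e f g p q u v w x y : A) (es : seq A).

(** The idempotents ab and ba = e are equivalent: (ab)x(ab) = a(bxa)b with bxa in eAe = Ke. *)
Lemma primitive_mul_swap e a b : primitive e -> a * e = a -> e * b = b ->
  b * a = e -> primitive (a * b).
Proof.
move=> [ee e_neq0 eP] ae eb ba; split.
- by rewrite mulrA -(mulrA a b a) ba ae.
- apply: contraNneq e_neq0 => ab0.
  by rewrite -ee -ba -mulrA (mulrA a) ab0 mul0r mulr0.
move=> x; have [c cE] := eP (b * x * a); exists c.
have -> : a * b * x * (a * b) = a * (e * (b * x * a) * e) * b.
  by rewrite !mulrA ae -[in RHS](mulrA _ e b) eb.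
by rewrite cE -scalerAr -scalerAl ae.
Qed.

Definition orthogonal_system es : Prop :=
  uniq es /\ {in es &, forall e f, e * f = e *+ (e == f)}.

Lemma orthogonal_system_suml es e : orthogonal_system es -> e \in es ->
  e * (\sum_(f <- es) f) = e.
Proof.
move=> [es_uniq es_orth] es_e; rewrite mulr_sumr (bigD1_seq e) //= es_orth //.
rewrite eqxx big_seq_cond big1 ?addr0 // => f /andP[es_f /negPf f_neq_e].
by rewrite es_orth // eq_sym f_neq_e.
Qed.

Lemma orthogonal_system_sumr es e : orthogonal_system es -> e \in es ->
  (\sum_(f <- es) f) * e = e.
Proof.
move=> [es_uniq es_orth] es_e; rewrite mulr_suml (bigD1_seq e) //= es_orth //.
rewrite eqxx big_seq_cond big1 ?addr0 // => f /andP[es_f /negPf f_neq_e].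
by rewrite es_orth // f_neq_e.
Qed.

(** Orthogonality passes from the sums to the members. A common member would satisfy e = ee = 0, so
    the lists are disjoint. *)
Lemma orthogonal_system_cat es1 es2 : {in es1, forall e, e != 0} ->
  orthogonal_system es1 -> orthogonal_system es2 ->
  (\sum_(e <- es1) e) * (\sum_(e <- es2) e) = 0 ->
  (\sum_(e <- es2) e) * (\sum_(e <- es1) e) = 0 ->
  orthogonal_system (es1 ++ es2).
Proof.
move=> nz1 os1 os2 s12 s21; have [[u1 o1] [u2 o2]] := (os1, os2).
have o12 e f : e \in es1 -> f \in es2 -> e * f = 0.
  move=> e1 f2; rewrite -(orthogonal_system_suml os1 e1).
  by rewrite -(orthogonal_system_sumr os2 f2) mulrA -(mulrA e) s12 mulr0 mul0r.
have o21 e f : e \in es1 -> f \in es2 -> f * e = 0.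
  move=> e1 f2; rewrite -(orthogonal_system_suml os2 f2).
  by rewrite -(orthogonal_system_sumr os1 e1) mulrA -(mulrA f) s21 mulr0 mul0r.
have d12 e : e \in es1 -> e \notin es2.
  move=> e1; apply: contraL (nz1 e e1) => e2; rewrite negbK.
  by have := o1 e e e1 e1; rewrite eqxx o12 // mulr1n => <-.
split.
  rewrite cat_uniq u1 u2 andbT /=; apply/hasPn => e e2.
  by apply: contraL e2; apply: d12.
move=> e f; rewrite !mem_cat => /orP[e1|e2] /orP[f1|f2]; auto.
- rewrite o12 //; case: eqVneq => // ef.
  by have := d12 e e1; rewrite ef f2.
- rewrite o21 //; case: eqVneq => // ef.
  by have := d12 f f1; rewrite -ef e2.
Qed.

End OrthogonalSystems.

(** * Complete orthogonal systems of primitive idempotents adapted to [S] *)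

Section Involution.
Variables (K : numClosedFieldType) (A : falgType K) (S : {linear A -> A}).
Hypothesis regA : regular_alg A.
Hypothesis SM : forall x y : A, S (x * y) = S y * S x.
Hypothesis SK : involutive S.
Implicit Types (a b e f g p q u v w x y : A) (es : seq A).

Lemma anti_inv1 : S 1 = 1.
Proof. by have := SM 1 (S 1); rewrite mul1r SK mul1r => <-. Qed.

Lemma anti_inv_primitive e : primitive e -> primitive (S e).
Proof.
move=> [ee e_neq0 eP]; split; first by rewrite -SM ee.
  by apply: contraNneq e_neq0 => Se0; rewrite -[e]SK Se0 linear0.
by move=> x; have [c cE] := eP (S x); exists c;
  rewrite -linearZ -cE !SM SK mulrA.
Qed.

(* On the symplectic summands and on those exchanged by S only the second
   alternative occurs, on the orthogonal ones only the first. *)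
Definition adapted e : Prop :=
  S e = e \/ [/\ e * S e = 0, S e * e = 0 &
                 forall x, S (e * x * S e) = - (e * x * S e)].

Lemma opp_fixed_eq0 x : x = - x -> x = 0.
Proof.
move/eqP; rewrite -addr_eq0 -mulr2n -scaler_nat scaler_eq0 pnatr_eq0 /=.
by move/eqP.
Qed.

(** Since (Se)e is nonzero, ue is a nonzero multiple de of [e], and u/d is an idempotent equivalent
    to [e] that inherits symmetry from [u]. *)
Lemma symmetric_primitive_of_link e u : primitive e -> e * u * S e = u ->
  S u = u -> u != 0 -> S e * e != 0 ->
  exists q, [/\ primitive q, S q = q & exists c, q = c *: u].
Proof.
move=> eP euf Su u_neq0 fe_neq0; have fP := anti_inv_primitive eP.
have [[ee _ eeP] [ff _ _]] := (eP, fP).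
have eu : e * u = u by rewrite -euf !mulrA ee.
have uf : u * S e = u by rewrite -euf -!mulrA ff.
have [d dE] := eeP u.
have ue : u * e = d *: e by rewrite -dE eu.
have d_neq0 : d != 0.
  have : u * (S e * e) != 0.
    by apply: (linked_mul_eq0 regA eP fP) => //; rewrite mulrA ff.
  by apply: contraNneq => d0; rewrite mulrA uf ue d0 scale0r.
exists (d^-1 *: u); split; last by exists d^-1.
  rewrite -eu scalerAl; apply: (primitive_mul_swap eP) => //.
    by rewrite -scalerAl ee.
  by rewrite -scalerAr ue scalerA mulVf ?scale1r.
by rewrite linearZ /= Su.
Qed.

Lemma adapted_below p : p * p = p -> S p = p -> p != 0 ->
  exists e, [/\ primitive e, adapted e & p * e * p = e].
Proof.
move=> pp Sp p_neq0; have [e eP pep] := primitive_below regA pp p_neq0.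
set f := S e; have fP : primitive f by apply: anti_inv_primitive.
have [[ee e_neq0 eeP] [ff f_neq0 _]] := (eP, fP).
have Sf : S f = e by rewrite /f SK.
have pe : p * e = e by rewrite -pep !mulrA pp.
have fp : f * p = f by rewrite /f -{2}pe SM Sp.
have ep : e * p = e by rewrite -pep -!mulrA pp.
have pf : p * f = f by rewrite /f -{2}ep SM Sp.
(* If S is -1 on eAf, then [e] is adapted: ef is symmetric, hence zero, and a nonzero fe would have
   an antisymmetric inverse, whence f = - f. *)
have [anti|] := pselect (forall x, S (e * x * f) = - (e * x * f)).
  exists e; split=> //; right; rewrite -/f; split=> //.
    by apply: opp_fixed_eq0; have := anti 1; rewrite mulr1 SM Sf -/f.
  apply/eqP; apply: contraNT f_neq0 => fe_neq0.
  have [|v [eve uv vu]] := primitive_inv regA fP eP _ fe_neq0.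
    by rewrite !mulrA ff -!mulrA ee.
  have Sv : S v = - v by rewrite -eve anti.
  apply/eqP; apply: opp_fixed_eq0; have := congr1 S vu.
  by rewrite SM Sv SM Sf -/f mulrN uv => ->.
move/existsNP=> [x0 /eqP]; rewrite -addr_eq0.
set u0 := e * x0 * f => Suu.
(* Otherwise a witness, symmetrized, gives a nonzero symmetric element of eAf; its inverse in fAe is
   symmetric too. *)
have [u [Su euf u_neq0]] : exists u, [/\ S u = u, e * u * f = u & u != 0].
  exists (S u0 + u0); split=> //; first by rewrite linearD SK addrC.
  rewrite mulrDr mulrDl /u0 !SM Sf -/f.
  by congr (_ + _); rewrite !mulrA ee -!mulrA ff.
have [v [fve uv vu]] := primitive_inv regA eP fP euf u_neq0.
have eu : e * u = u by rewrite -euf !mulrA ee.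
have uf : u * f = u by rewrite -euf -!mulrA ff.
have fv : f * v = v by rewrite -fve !mulrA ff.
have ve : v * e = v by rewrite -fve -!mulrA ee.
have Sv : S v = v.
  have : S v * u = f by rewrite -{1}Su -SM uv.
  move/(congr1 ( *%R^~ v)); rewrite /= -mulrA uv fv => Sve.
  by rewrite -[RHS]Sve -{1}fv SM Sf.
have v_neq0 : v != 0.
  by apply: contraNneq e_neq0 => v0; rewrite -uv v0 mulr0.
(* If fe or ef is nonzero, a multiple of [u] or [v] respectively is a symmetric primitive
   idempotent. *)
have [fe0|fe_neq0] := eqVneq (f * e) 0; last first.
  have [q [qP Sq [c qE]]] := symmetric_primitive_of_link eP euf Su u_neq0
    fe_neq0.
  exists q; split=> //; first by left.
  by rewrite qE -scalerAr -scalerAl -euf !mulrA pe -!mulrA fp.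
have [ef0|ef_neq0] := eqVneq (e * f) 0; last first.
  have [||q [qP Sq [c qE]]] := symmetric_primitive_of_link fP _ Sv v_neq0.
  - by rewrite Sf.
  - by rewrite Sf.
  exists q; split=> //; first by left.
  by rewrite qE -scalerAr -scalerAl -fve !mulrA pf -!mulrA ep.
have ev : e * v = 0 by rewrite -fv mulrA ef0 mul0r.
have ue : u * e = 0 by rewrite -uf -mulrA fe0 mulr0.
(* If e and f are orthogonal then (e + u + v + f) / 2 is a symmetric primitive
   idempotent. *)
pose q := (2^-1 *: (e + v)) * (e + u).
have qE : q = 2^-1 *: (e + u + v + f).
  by rewrite /q -scalerAl mulrDl !mulrDr ee eu ve vu addrA.
have qP : primitive q.
  apply: (primitive_mul_swap eP).
  - by rewrite -scalerAl mulrDl ee ve.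
  - by rewrite mulrDr ee eu.
  rewrite -scalerAr mulrDl !mulrDr ee ev ue uv addr0 add0r.
  by rewrite -mulr2n -scaler_nat scalerA mulVf ?scale1r ?pnatr_eq0.
exists q; split=> //.
  have Ssum : S (e + u + v + f) = e + u + v + f.
    rewrite !linearD /= Su Sv -/f Sf addrC -!addrA.
    by rewrite [f + _]addrC -addrA.
  by left; rewrite qE linearZ /= Ssum.
rewrite qE -scalerAr -scalerAl; congr (_ *: _).
rewrite !mulrDr !mulrDl pep pf fp -euf -fve !mulrA pe pf.
by rewrite -!mulrA ep fp.
Qed.

(** A nonzero y in (Se)Ae has an inverse v in eA(Se), where Sv = - v. Applying S to vy = e gives -
    (Sy)v = yv, and cancelling v gives Sy = - y. *)
Lemma adapted_anti_inv e : primitive e -> adapted e -> adapted (S e).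
Proof.
move=> eP [Se|[ef fe anti]]; first by left; rewrite !Se.
have fP := anti_inv_primitive eP; have [[ee _ _] [ff _ _]] := (eP, fP).
right; rewrite SK; split=> // x; set y := S e * x * e.
have [->|y_neq0] := eqVneq y 0; first by rewrite linear0 oppr0.
have fye : S e * y * e = y by rewrite /y !mulrA ff -!mulrA ee.
have [v [evf yv vy]] := primitive_inv regA fP eP fye y_neq0.
have Sye : S y * e = S y by rewrite /y !SM SK -!mulrA ee.
have ye : y * e = y by rewrite /y -!mulrA ee.
clearbody y; have Sv : S v = - v by rewrite -evf anti.
have := congr1 S vy; rewrite SM Sv mulrN -yv => /(congr1 ( *%R^~ y)).
by rewrite /= mulNr -!mulrA vy Sye ye => /eqP; rewrite eqr_oppLR => /eqP.
Qed.

(** Split off one S-orbit of adapted idempotents from [p] and recurse on the symmetric remainder,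
    whose corner has smaller dimension. *)
Lemma adapted_system p : p * p = p -> S p = p -> exists es : seq A,
  [/\ orthogonal_system es,
      {in es, forall e, [/\ primitive e, adapted e & S e \in es]} &
      \sum_(e <- es) e = p].
Proof.
have [n] := ubnP (\dim (corner p)); elim: n p => // n IHn p le_n pp Sp.
have [->|p_neq0] := eqVneq p 0; first by exists [::]; rewrite big_nil; split.
have [e [eP eA pep]] := adapted_below pp Sp p_neq0.
have [ee e_neq0 _] := eP; have fP := anti_inv_primitive eP.
have [bs [bs_orth bsP bs_corner bs_e]] : exists bs : seq A,
  [/\ orthogonal_system bs,
      {in bs, forall e, [/\ primitive e, adapted e & S e \in bs]},
      {in bs, forall e, p * e * p = e} & e \in bs].
  have [Se|Se_neq] := eqVneq (S e) e.
    exists [:: e]; rewrite mem_head; split=> //.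
    - by split=> // x y; rewrite !inE => /eqP-> /eqP->; rewrite ee eqxx.
    - by move=> x; rewrite inE => /eqP->; rewrite Se mem_head.
    - by move=> x; rewrite inE => /eqP->.
  case: eA => [/eqP|[ef fe anti]]; first by rewrite (negPf Se_neq).
  have pep1 : p * S e * p = S e by rewrite -[in RHS]pep !SM Sp mulrA.
  exists [:: e; S e]; rewrite mem_head; split=> //.
  - split=> [|x y]; first by rewrite /= inE eq_sym Se_neq.
    have [ff _ _] := fP.
    rewrite !inE => /orP[]/eqP-> /orP[]/eqP->; rewrite ?eqxx //.
      by rewrite ef eq_sym (negPf Se_neq).
    by rewrite fe (negPf Se_neq).
  - move=> x; rewrite !inE => /orP[]/eqP->; rewrite ?SK ?eqxx ?orbT; split=> //.
      by right.
    by apply: adapted_anti_inv => //; right.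
  - by move=> x; rewrite !inE => /orP[]/eqP->.
pose q := \sum_(b <- bs) b.
have pq : p * q = q.
  rewrite /q mulr_sumr; apply: eq_big_seq => b /bs_corner <-.
  by rewrite !mulrA pp.
have qp : q * p = q.
  rewrite /q mulr_suml; apply: eq_big_seq => b /bs_corner <-.
  by rewrite -!mulrA pp.
have qq : q * q = q.
  by rewrite {1}/q mulr_suml; apply: eq_big_seq => b;
    apply: orthogonal_system_suml.
have Sq : S q = q.
  rewrite /q linear_sum -(big_map S xpredT id); apply: perm_big.
  have [bs_uniq _] := bs_orth.
  apply: uniq_perm => //; first by rewrite (map_inj_uniq (inv_inj SK)).
  move=> x; apply/mapP/idP => [[y /bsP[_ _ bs_y] -> //]|/bsP[_ _ bs_x]].
  by exists (S x); rewrite ?SK.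
have q_neq0 : q != 0.
  apply: contraNneq e_neq0 => q0.
  by rewrite -(orthogonal_system_suml bs_orth bs_e) -/q q0 mulr0.
pose r := p - q.
have rr : r * r = r by rewrite /r mulrBl !mulrBr pp pq qp qq subrr subr0.
have Sr : S r = r by rewrite /r linearB /= Sp Sq.
have prp : p * r * p = r by rewrite /r mulrBr mulrBl pp pq qp pp.
have r_neq_p : r != p by rewrite /r -subr_eq0 addrAC subrr add0r oppr_eq0.
have [|es [es_orth esP sum_es]] := IHn r _ rr Sr.
  by rewrite (leq_trans (corner_dim_lt pp rr prp r_neq_p)) // -ltnS.
exists (bs ++ es); split.
- apply: orthogonal_system_cat => //; first by move=> x /bsP[[]].
    by rewrite sum_es -/q /r mulrBr qp qq subrr.
  by rewrite sum_es -/q /r mulrBl pq qq subrr.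
- move=> x; rewrite !mem_cat => /orP[/bsP|/esP] [xP xA Sx]; split=> //;
  by rewrite Sx ?orbT.
- by rewrite big_cat /= sum_es -/q /r addrC subrK.
Qed.

End Involution.

(** * Generation *)

Section GeneratedAlgebra.
Variables (K : numClosedFieldType) (A : falgType K) (X : seq A).
Implicit Types (x y a : A) (r : {poly K}).

Definition in_gen x : Prop := exists2 ws : seq (seq A),
  all (fun w => (w != [::]) && all (mem X) w) ws &
  x \in <<[seq \prod_(y <- w) y | w <- ws]>>%VS.

Lemma in_gen_mem x : x \in X -> in_gen x.
Proof.
move=> Xx; exists [:: [:: x]]; first by rewrite /= Xx.
by rewrite /= big_seq1 memv_span1.
Qed.

Lemma in_gen0 : in_gen 0.
Proof. by exists [::] => //; rewrite mem0v. Qed.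

Lemma in_genD x y : in_gen x -> in_gen y -> in_gen (x + y).
Proof.
move=> [ws1 X1 x1] [ws2 X2 y2]; exists (ws1 ++ ws2);
  first by rewrite all_cat X1.
by rewrite map_cat span_cat memv_add.
Qed.

Lemma in_genZ c x : in_gen x -> in_gen (c *: x).
Proof. by move=> [ws Xws x_ws]; exists ws => //; rewrite memvZ. Qed.

(** Concatenated words span the target; pulling it back along multiplication by [y], then along
    multiplication by one word, reduces the claim to two words. *)
Lemma in_genM x y : in_gen x -> in_gen y -> in_gen (x * y).
Proof.
move=> [ws1 X1 x1] [ws2 X2 y2]; exists [seq w1 ++ w2 | w1 <- ws1, w2 <- ws2].
  apply/allP=> w /allpairsP[[w1 w2] /= [/(allP X1)/andP[n1 a1] /(allP
    X2)/andP[_ a2] ->]].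
  by rewrite all_cat a1 a2 andbT; case: (w1) n1.
set U := <<_>>%VS.
suff sub2 w1 : w1 \in ws1 -> \prod_(z <- w1) z * y \in U.
  suff /subvP/(_ x x1) : (<<[seq (\prod_(z <- w) z)%R | w <- ws1]>>
      <= amulr y @^-1: U)%VS by rewrite -memv_preim lfunE.
  apply/span_subvP => _ /mapP[w ws1w ->].
  by rewrite -memv_preim lfunE sub2.
move=> w1_in; suff /subvP/(_ y y2) : (<<[seq (\prod_(z <- w) z)%R | w <- ws2]>>
      <= amull (\prod_(z <- w1) z)%R @^-1: U)%VS by rewrite -memv_preim lfunE.
apply/span_subvP => _ /mapP[w ws2w ->].
rewrite -memv_preim lfunE /= -big_cat memv_span //; apply: map_f.
by apply/allpairsP; exists (w1, w).
Qed.

Lemma in_gen_sum (I : eqType) (s : seq I) (F : I -> A) :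
  {in s, forall i, in_gen (F i)} -> in_gen (\sum_(i <- s) F i).
Proof.
move=> sF; rewrite big_seq; apply: big_ind => //; first exact: in_gen0.
exact: in_genD.
Qed.

(** The factor ['X] removes the constant term, for which no non-empty word is at hand. *)
Lemma in_gen_horner a r : in_gen a -> in_gen (horner_alg a ('X * r)).
Proof.
move=> Xa; elim/poly_ind: r => [|r c IHr].
  by rewrite mulr0 rmorph0; apply: in_gen0.
rewrite mulrDr mulrA rmorphD rmorphM /= horner_algX; apply: in_genD.
  exact: in_genM.
by rewrite rmorphM /= horner_algX horner_algC mulr_algr; apply: in_genZ.
Qed.

End GeneratedAlgebra.

(** * Recovering idempotents as polynomials in one element *)

Section Separation.
Variables (K : numClosedFieldType) (A : falgType K).
Implicit Types (x y a e f u b : A) (r p : {poly K}) (E : seq A).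

Lemma horner_alg_intertwine a b u r :
  a * u = u * b -> horner_alg a r * u = u * horner_alg b r.
Proof.
move=> au; elim/poly_ind: r => [|r c IHr];
  first by rewrite !rmorph0 mul0r mulr0.
rewrite !rmorphD !rmorphM /= !horner_algX !horner_algC mulrDl mulrDr.
by rewrite -mulrA au mulrA IHr mulrA mulr_algl mulr_algr.
Qed.

Lemma horner_alg_eigen a e c r :
  a * e = c *: e -> horner_alg a r * e = r.[c] *: e.
Proof.
move=> ae; elim/poly_ind: r => [|r k IHr].
  by rewrite rmorph0 mul0r horner0 scale0r.
rewrite rmorphD rmorphM /= horner_algX horner_algC mulrDl -mulrA ae -scalerAr
  IHr.
by rewrite mulr_algl scalerA -scalerDl hornerMXaddC mulrC.
Qed.

(* Since h and x annihilate each other, q(h + x) = q(h) + q(x) up to the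
   constant term; take q vanishing at x and interpolating on the spectrum of h.
     *)
Lemma horner_alg_separate E (lam : A -> K) x p e :
  orthogonal_system E -> {in E &, injective lam} ->
  {in E, forall f, [/\ f * x = 0, x * f = 0, lam f != 0 & p.[lam f] != 0]} ->
  horner_alg x p = 0 -> e \in E ->
  exists r, horner_alg (\sum_(f <- E) lam f *: f + x) ('X * r) = e.
Proof.
move=> E_orth lam_inj E_x px0 Ee; set a := _ + x.
have [E_uniq E_mul] := E_orth.
pose q := 'X * (p * \prod_(f <- E | f != e) ('X - (lam f)%:P)).
have qe_neq0 : q.[lam e] != 0.
  have [_ _ lam_neq0 p_neq0] := E_x e Ee.
  rewrite !hornerM hornerX !mulf_neq0 // horner_prod prodf_seq_neq0.
  apply/allP => f Ef; apply/implyP => f_neq_e.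
  by rewrite hornerXsubC subr_eq0; apply: contraNneq f_neq_e => /lam_inj->.
have q_other f : f \in E -> f != e -> q.[lam f] = 0.
  move=> Ef f_neq_e; apply/eqP; rewrite !hornerM !mulf_eq0 horner_prod.
  rewrite prodf_seq_eq0; apply/orP; right; apply/orP; right.
  by apply/hasP; exists f => //; rewrite f_neq_e hornerXsubC subrr eqxx.
have af f : f \in E -> a * f = lam f *: f.
  move=> Ef; have [_ xf _ _] := E_x f Ef.
  rewrite mulrDl xf addr0 mulr_suml (bigD1_seq f) //= -scalerAl E_mul // eqxx.
  rewrite big_seq_cond big1 ?addr0 // => g /andP[Eg /negPf g_neq_f].
  by rewrite -scalerAl E_mul // g_neq_f scaler0.
(* On the complement [d] of the idempotents, [a] acts as [x], where [q] vanishes; on each f in [E]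
   it acts as a scalar. *)
pose d := 1 - \sum_(f <- E) f.
have ad : a * d = d * x.
  rewrite mulrBr mulr1 mulrBl mul1r mulr_sumr mulr_suml.
  have -> : \sum_(f <- E) a * f = \sum_(f <- E) lam f *: f.
    exact: eq_big_seq.
  have -> : \sum_(f <- E) f * x = 0.
    by rewrite big_seq big1 // => f /E_x[].
  by rewrite addrAC subrr add0r subr0.
exists (q.[lam e]^-1 *: (p * \prod_(f <- E | f != e) ('X - (lam f)%:P))).
rewrite -scalerAr -/q horner_algZ.
have -> : horner_alg a q = q.[lam e] *: e.
  rewrite -[LHS]mulr1 -(subrK (\sum_(f <- E) f) 1) -/d mulrDr.
  rewrite (horner_alg_intertwine _ ad) /q !rmorphM /= px0 mul0r !mulr0 add0r.
  rewrite -!rmorphM -/q mulr_sumr (bigD1_seq e) //=.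
  rewrite (horner_alg_eigen _ (af e Ee)) big_seq_cond big1 ?addr0 //.
  by move=> f /andP[Ef fe];
    rewrite (horner_alg_eigen _ (af f Ef)) q_other // scale0r.
by rewrite scalerA mulVf // scale1r.
Qed.

(** Any non-root t of the product [q] works: the factor ['X] keeps t nonzero, and the others,
    p(mu(e) X), are nonzero polynomials since mu(e) is nonzero. *)
Lemma exists_scale_avoiding_roots E (mu : A -> K) p : p != 0 ->
  {in E, forall e, mu e != 0} ->
  exists t : K, t != 0 /\ {in E, forall e, p.[t * mu e] != 0}.
Proof.
move=> p_neq0 mu_neq0.
pose q := 'X * \prod_(e <- E | mu e != 0) (p \Po (mu e *: 'X)).
have : q != 0.
  rewrite mulf_neq0 ?polyX_eq0 // prodf_seq_neq0.
  apply/allP => e Ee; apply/implyP => mue.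
  by rewrite -size_poly_eq0 size_comp_poly2 ?size_poly_eq0 // size_scale //
    size_polyX.
case/closed_nonrootP=> t; rewrite rootE hornerM hornerX mulf_eq0 negb_or.
rewrite horner_prod prodf_seq_neq0 => /andP[t_neq0 /allP p_t].
exists t; split=> // e Ee; have := p_t e Ee.
by rewrite mu_neq0 // horner_comp hornerZ hornerX mulrC.
Qed.

End Separation.

(** * Construction of the generator from weights and perturbations *)

Section Generation.
Variables (K : numClosedFieldType) (A : falgType K) (S : {linear A -> A}).
Hypothesis regA : regular_alg A.
Hypothesis SM : forall x y : A, S (x * y) = S y * S x.
Hypothesis SK : involutive S.
Implicit Types (a b e f g p q u v w x y : A) (es E : seq A).

Lemma stable_map_perm E : uniq E -> {in E, forall e, S e \in E} ->
  perm_eq (map S E) E.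
Proof.
move=> E_uniq SE; apply: uniq_perm; rewrite ?(map_inj_uniq (inv_inj SK)) //.
move=> x; apply/mapP/idP => [[y /SE Ey -> //]|Ex].
by exists (S x); rewrite ?SK ?SE.
Qed.

Lemma linked_anti_inv e f : linked e f -> linked (S f) (S e).
Proof.
move/linkedP=> [x exf]; apply/linkedP; exists (S x).
apply: contraNneq exf => /(congr1 S).
by rewrite !SM !SK linear0 mulrA => ->.
Qed.

(** If u = exf is nonzero, so is (Su)u, a symmetric element of (Sf)Af. This excludes the case where
    S is -1 there. *)
Lemma linked_fixed e f : primitive e -> primitive f -> adapted S f ->
  S e = e -> linked e f -> S f = f.
Proof.
move=> eP fP fA Se /linkedP[x]; set u := e * x * f => u_neq0.
have sfP := anti_inv_primitive SM SK fP.
case: (adapted_anti_inv regA SM SK fP fA) => [|[_ _ anti]].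
  by rewrite SK.
have [ee _ _] := eP; have [ff _ _] := fP.
have Su_neq0 : S u != 0.
  by apply: contraNneq u_neq0 => Su0; rewrite -[u]SK Su0 linear0.
have sfSu : S f * S u * e = S u by rewrite /u !SM Se !mulrA -SM ff -!mulrA ee.
have eu : e * u = u by rewrite /u !mulrA ee.
have := linked_mul_eq0 regA sfP eP sfSu eu Su_neq0 u_neq0.
have SuuE : S f * (S u * u) * S (S f) = S u * u.
  by rewrite SK /u !SM !mulrA -SM ff -!mulrA ff.
have := anti (S u * u); rewrite SuuE SM SK => /opp_fixed_eq0 ->.
by rewrite eqxx.
Qed.

(** S carries eAf to (Sf)A(Se). If these are indexed by different pairs, one entry is free and [eps]
    determines the other; if f = Se, the corner is mapped to itself with a sign that may disagree
    with [eps], and the entry is set to 0. *)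
Lemma signed_perturbation E (eps : K) : eps * eps = 1 ->
  orthogonal_system E -> {in E, forall e, S e \in E} ->
  exists x, [/\ S x = eps *: x,
    (\sum_(e <- E) e) * x = x, x * (\sum_(e <- E) e) = x &
    {in E &, forall e f, linked e f -> S f != e -> e * x * f != 0}].
Proof.
move=> eps2 E_orth SE; have [E_uniq E_mul] := E_orth.
have [y yP] : {y : A * A -> A &
    forall p : A * A, linked p.1 p.2 -> p.1 * y p * p.2 != 0}.
  apply: (boolp.choice (P := fun (p : A * A) z =>
    linked p.1 p.2 -> p.1 * z * p.2 != 0)) => p.
  case: (boolP (linked p.1 p.2)) => [/linkedP[z z_neq0]|_]; last by exists 0.
  by exists z.
pose w (p : A * A) := p.1 * y p * p.2.
pose tau (p : A * A) := (S p.2, S p.1).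
have tauK : involutive tau by case=> e f; rewrite /tau /= !SK.
pose P := [seq (e, f) | e <- E, f <- E].
have P_mem (p : A * A) : (p \in P) = (p.1 \in E) && (p.2 \in E).
  apply/allpairsP/andP => [[[e f] /= [Ee Ef ->]] //|[Ee Ef]].
  by exists p; split=> //; case: (p).
have P_uniq : uniq P by apply: allpairs_uniq => // - [? ?] [? ?].
have tauP (p : A * A) : p \in P -> tau p \in P.
  by rewrite !P_mem => /andP[/SE ? /SE ?]; apply/andP.
have tau_perm : perm_eq (map tau P) P.
  apply: uniq_perm; rewrite ?(map_inj_uniq (inv_inj tauK)) //.
  move=> p; apply/mapP/idP => [[q Pq ->]|Pp]; first exact: tauP.
  by exists (tau p); rewrite ?tauK ?tauP.
(* S acts on pairs through tau; on a free tau-orbit only the entry of smaller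
   index is chosen, the other one is its image. *)
pose z (p : A * A) := if tau p == p then 0 else
  if (index p P < index (tau p) P)%N then w p else eps *: S (w (tau p)).
have Sz (p : A * A) : p \in P -> S (z p) = eps *: z (tau p).
  move=> Pp; rewrite /z tauK eq_sym; case: eqVneq => [_|p_neq].
    by rewrite linear0 scaler0.
  case: ltngtP => [_|_|eq_index]; first by rewrite scalerA eps2 scale1r.
    by rewrite linearZ /= SK.
  by case/eqP: p_neq; apply: index_inj eq_index => //; apply: tauP.
have zl (p : A * A) : p \in P -> p.1 * z p = z p.
  rewrite P_mem => /andP[E1 E2]; rewrite /z; case: ifP => _;
    first by rewrite mulr0.
  have p11 : p.1 * p.1 = p.1 by rewrite E_mul // eqxx.
  case: ifP => _; first by rewrite /w !mulrA p11.
  by rewrite -scalerAr /w /tau /= !SM SK !mulrA p11.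
have zr (p : A * A) : p \in P -> z p * p.2 = z p.
  rewrite P_mem => /andP[E1 E2]; rewrite /z; case: ifP => _;
    first by rewrite mul0r.
  have p22 : p.2 * p.2 = p.2 by rewrite E_mul // eqxx.
  case: ifP => _; first by rewrite /w -!mulrA p22.
  by rewrite -scalerAl /w /tau /= !SM !SK -!mulrA p22.
exists (\sum_(p <- P) z p); split.
- rewrite linear_sum [LHS](eq_big_seq _ Sz) -scaler_sumr; congr (_ *: _).
  by rewrite -[RHS](perm_big _ tau_perm) big_map.
- rewrite mulr_sumr; apply: eq_big_seq => p Pp; rewrite -{1}zl //.
  have := Pp; rewrite P_mem => /andP[E1 _].
  by rewrite mulrA orthogonal_system_sumr // zl.
- rewrite mulr_suml; apply: eq_big_seq => p Pp; rewrite -{1}zr //.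
  have := Pp; rewrite P_mem => /andP[_ E2].
  by rewrite -mulrA orthogonal_system_suml // zr.
move=> e f Ee Ef ef Sf_neq_e.
have Pef : (e, f) \in P by rewrite P_mem Ee.
rewrite mulr_sumr mulr_suml (bigD1_seq (e, f)) //= (zl _ Pef) (zr _ Pef).
rewrite big_seq_cond big1 ?addr0; last first.
  move=> p /andP[Pp p_neq]; have zE : z p = p.1 * z p * p.2 by rewrite zl // zr.
  have := Pp; rewrite P_mem => /andP[E1 E2].
  rewrite zE !mulrA -(mulrA _ p.2 f) (E_mul e) // (E_mul p.2) //.
  case: (eqVneq e p.1) => [e1|_].
    case: eqVneq => [f2|_]; last by rewrite mulr0n mulr0.
    by case/eqP: p_neq; rewrite e1 -f2; case: (p).
  by rewrite mulr0n !mul0r.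
rewrite /z /tau /= xpair_eqE (negPf Sf_neq_e) /=.
case: ifP => _; first exact: yP.
rewrite scaler_eq0 negb_or; apply/andP; split.
  by apply: contraTneq (oner_neq0 K) => eps0; rewrite -eps2 eps0 mul0r eqxx.
have := yP (S f, S e) (linked_anti_inv ef).
apply: contraNneq => Sw0; apply/eqP.
by rewrite -[LHS]SK -/(w (S f, S e)) Sw0 linear0.
Qed.

(** Of [e] and its partner, the one listed first gets its position plus one, the other the opposite;
    the shift keeps all weights nonzero. *)
Lemma signed_weights E : uniq E -> {in E, forall e, S e \in E} ->
  {in E, forall e, S e != e} ->
  exists mu : A -> K, [/\ {in E &, injective mu}, {in E, forall e, mu e != 0} &
    {in E, forall e, mu (S e) = - mu e}].
Proof.
move=> E_uniq SE S_free; pose i e := index e E.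
exists (fun e => if (i e < i (S e))%N then (i e).+1%:R else - (i (S e)).+1%:R).
have i_inj e f : e \in E -> f \in E -> i e = i f -> e = f.
  by move=> Ee Ef; apply: index_inj.
have pos_neg m n : (m.+1%:R : K) <> - n.+1%:R.
  by move/eqP; rewrite -addr_eq0 -natrD pnatr_eq0.
split=> [e f Ee Ef|e Ee|e Ee].
- case: ifP => _; case: ifP => _.
  + by move/eqP; rewrite eqr_nat eqSS => /eqP /i_inj; apply.
  + by move/pos_neg.
  + by move/esym/pos_neg.
  move/oppr_inj/eqP; rewrite eqr_nat eqSS => /eqP eqi.
  by apply: (inv_inj SK); apply: i_inj eqi; apply: SE.
- by case: ifP => _; rewrite ?oppr_eq0 pnatr_eq0.
rewrite SK; case: ltngtP => [_|_|eqi]; rewrite ?opprK //.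
by case/eqP: (S_free e Ee); apply: i_inj eqi; rewrite ?SE.
Qed.

Lemma plain_weights E : exists mu : A -> K,
  {in E &, injective mu} /\ {in E, forall e, mu e != 0}.
Proof.
exists (fun e => (index e E).+1%:R); split=> [e f Ee Ef /eqP|e _].
  by rewrite eqr_nat eqSS => /eqP; apply: index_inj.
by rewrite pnatr_eq0.
Qed.

(** Rescaling by a suitable t moves the weights off the roots of a polynomial annihilating [x], and
    [horner_alg_separate] applies. *)
Lemma diag_separated E (mu : A -> K) x : orthogonal_system E ->
  {in E &, injective mu} -> {in E, forall e, mu e != 0} ->
  {in E, forall f, f * x = 0 /\ x * f = 0} ->
  exists2 t : K, t != 0 &
    {in E, forall e, exists r,
      horner_alg (\sum_(f <- E) (t * mu f) *: f + x) ('X * r) = e}.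
Proof.
move=> E_orth mu_inj mu_neq0 E_x; have [p p_neq0 px0] := annihilating_poly x.
have [t [t_neq0 p_t]] := exists_scale_avoiding_roots p_neq0 mu_neq0.
exists t => // e Ee; apply: (horner_alg_separate (p := p)) => //.
  by move=> f g Ef Eg /(mulfI t_neq0); apply: mu_inj.
by move=> f Ef; have [fx xf] := E_x f Ef; rewrite mulf_neq0 ?mu_neq0 // p_t.
Qed.

Lemma generates_of_third_link es : orthogonal_system es ->
  {in es, forall e, [/\ primitive e, adapted S e & S e \in es]} ->
  \sum_(e <- es) e = 1 ->
  {in es, forall e, S e != e -> linked e (S e) ->
    exists f, [/\ f \in es, linked e f, f != e & f != S e]} ->
  exists a, generates_alg [:: a; S a].
Proof.
move=> es_orth esP es_sum third; have [es_uniq es_mul] := es_orth.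
pose EO := [seq e <- es | S e == e]; pose EF := [seq e <- es | S e != e].
have EO_es e : e \in EO -> S e = e /\ e \in es.
  by rewrite mem_filter => /andP[/eqP].
have EF_es e : e \in EF -> S e != e /\ e \in es.
  by rewrite mem_filter => /andP[].
have EO_orth : orthogonal_system EO.
  split; first exact: filter_uniq.
  by move=> e f /EO_es[_ ?] /EO_es[_ ?]; apply: es_mul.
have EF_orth : orthogonal_system EF.
  split; first exact: filter_uniq.
  by move=> e f /EF_es[_ ?] /EF_es[_ ?]; apply: es_mul.
have SO : {in EO, forall e, S e \in EO}.
  by move=> e Oe; have [-> _] := EO_es e Oe.
have SF : {in EF, forall e, S e \in EF}.
  move=> e /EF_es[Se es_e]; rewrite mem_filter SK eq_sym Se.
  by have [] := esP e es_e.
have OF e f : e \in EO -> f \in EF -> e * f = 0 /\ f * e = 0.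
  move=> /EO_es[Se es_e] /EF_es[Sf es_f].
  have e_neq_f : e != f by apply: contraNneq Sf => <-; apply/eqP.
  by rewrite !es_mul // [f == e]eq_sym (negPf e_neq_f).
(* Each sign matches the diagonal part to which the perturbation will be added: [xF] goes with [hO],
   fixed by S, and [xO] with [hF], negated by S. *)
have [xF [SxF xFl xFr xF_link]] := signed_perturbation (mulr1 1) EF_orth SF.
have eps2 : (-1) * (-1) = 1 :> K by rewrite mulrNN mulr1.
have [xO [SxO xOl xOr xO_link]] := signed_perturbation eps2 EO_orth SO.
have O_xF : {in EO, forall e, e * xF = 0 /\ xF * e = 0}.
  move=> e Oe; rewrite -xFl mulrA mulr_sumr big_seq big1 ?mul0r; last first.
    by move=> f Ff; have [] := OF e f Oe Ff.
  rewrite xFl -xFr -mulrA mulr_suml big_seq big1 ?mulr0 //.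
  by move=> f Ff; have [] := OF e f Oe Ff.
have F_xO : {in EF, forall f, f * xO = 0 /\ xO * f = 0}.
  move=> f Ff; rewrite -xOl mulrA mulr_sumr big_seq big1 ?mul0r; last first.
    by move=> e Oe; have [] := OF e f Oe Ff.
  rewrite xOl -xOr -mulrA mulr_suml big_seq big1 ?mulr0 //.
  by move=> e Oe; have [] := OF e f Oe Ff.
have [muO [muO_inj muO_neq0]] := plain_weights EO.
have [tO _ O_sep] := diag_separated EO_orth muO_inj muO_neq0 O_xF.
have [|muF [muF_inj muF_neq0 SmuF]] :=
  signed_weights (filter_uniq _ es_uniq : uniq EF) SF.
  by move=> e /EF_es[].
have [tF _ F_sep] := diag_separated EF_orth muF_inj muF_neq0 F_xO.
pose hO := \sum_(e <- EO) (tO * muO e) *: e.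
pose hF := \sum_(e <- EF) (tF * muF e) *: e.
have ShO : S hO = hO.
  rewrite linear_sum; apply: eq_big_seq => e /EO_es[Se _].
  by rewrite linearZ /= Se.
have ShF : S hF = - hF.
  have [F_uniq _] := EF_orth.
  rewrite linear_sum -sumrN -[RHS](perm_big _ (stable_map_perm F_uniq SF))
    big_map.
  apply: eq_big_seq => e Fe.
  by rewrite linearZ /= SmuF // mulrN scaleNr opprK.
pose s := hO + xF; pose k := hF + xO.
have Ss : S s = s by rewrite /s linearD /= ShO SxF scale1r.
have Sk : S k = - k by rewrite /k linearD /= ShF SxO scaleN1r opprD.
exists (s + k); set a := s + k; pose G := in_gen [:: a; S a].
have Sa : S a = s - k by rewrite /a linearD /= Ss Sk.
have Ga : G a by apply: in_gen_mem; rewrite mem_head.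
have GSa : G (S a) by apply: in_gen_mem; rewrite inE mem_head orbT.
have two_neq0 : (2%:R : K) != 0 by rewrite pnatr_eq0.
have Gs : G s.
  have -> : s = 2%:R^-1 *: (a + S a).
    by rewrite Sa /a addrACA subrr addr0 -mulr2n -scaler_nat scalerA mulVf
      ?scale1r.
  by apply: in_genZ; apply: in_genD.
have Gk : G k.
  have -> : k = 2%:R^-1 *: (a + (-1) *: S a).
    rewrite Sa /a scaleN1r opprB [s + k + _]addrC addrA subrK.
    by rewrite -mulr2n -scaler_nat scalerA mulVf ?scale1r.
  by apply: in_genZ; apply: in_genD => //; apply: in_genZ.
have Ge e : e \in es -> G e.
  move=> es_e; case: (boolP (S e == e)) => Se.
    have [|r <-] := O_sep e; first by rewrite mem_filter Se.
    exact: in_gen_horner.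
  have [|r <-] := F_sep e; first by rewrite mem_filter Se.
  exact: in_gen_horner.
(* Linked idempotents are of the same kind. Between them the diagonal part of the other kind
   vanishes, and the perturbation does not unless f = Se. *)
have direct e f : e \in es -> f \in es -> linked e f -> S f != e ->
    exists2 w, e * w * f != 0 & G (e * w * f).
  move=> es_e es_f ef Sf_neq;
    have [[eP _ _] [fP fA _]] := (esP e es_e, esP f es_f).
  have [[ee _ _] [ff _ _]] := (eP, fP).
  case: (boolP (S e == e)) => Se.
    have Sf : S f == f.
      by apply/eqP; apply: (linked_fixed eP fP fA (eqP Se) ef).
    have Oe : e \in EO by rewrite mem_filter Se.
    have Of : f \in EO by rewrite mem_filter Sf.
    exists k; last exact: in_genM (in_genM (Ge e es_e) Gk) (Ge f es_f).
    have -> : e * k * f = e * xO * f.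
      rewrite /k mulrDr mulrDl /hF mulr_sumr big_seq big1 ?mul0r ?add0r //.
      by move=> g Fg; rewrite -scalerAr; have [-> _] := OF e g Oe Fg;
        rewrite scaler0.
    exact: xO_link.
  have Sf : S f != f.
    apply: contraNneq Se => Sf; apply/eqP.
    have [_ eA _] := esP e es_e.
    by apply: (linked_fixed fP eP eA Sf); apply: (linked_sym regA).
  have Fe : e \in EF by rewrite mem_filter Se.
  have Ff : f \in EF by rewrite mem_filter Sf.
  exists s; last exact: in_genM (in_genM (Ge e es_e) Gs) (Ge f es_f).
  have -> : e * s * f = e * xF * f.
    rewrite /s mulrDr mulrDl /hO mulr_sumr big_seq big1 ?mul0r ?add0r //.
    by move=> g Og; rewrite -scalerAr; have [_ ->] := OF g e Og Fe;
      rewrite scaler0.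
  exact: xF_link.
have all_links e f : e \in es -> f \in es -> linked e f ->
    exists2 w, e * w * f != 0 & G (e * w * f).
  move=> es_e es_f ef; have [[eP eA _] [fP _ _]] := (esP e es_e, esP f es_f).
  have [[ee e_neq0 _] [ff _ _]] := (eP, fP).
  have [Sfe|Sf_neq] := eqVneq (S f) e; last exact: direct.
  have fE : f = S e by rewrite -Sfe SK.
  have [Se|Se_neq] := eqVneq (S e) e.
    by exists e; rewrite fE Se ?ee //; apply: Ge.
  rewrite fE in ef es_f fP ff *.
  (* The perturbations supply nothing from [e] to [S e]; that line is reached through the third
     idempotent g. *)
  have [g [es_g eg g_neq_e g_neq_Se]] := third e es_e Se_neq ef.
  have [gP gA _] := esP g es_g; have [gg _ _] := gP.
  have [|w1 w1_neq0 Gw1] := direct e g es_e es_g eg.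
    by apply: contraNneq g_neq_Se => <-; rewrite SK.
  have gSe : linked g (S e).
    by apply: (linked_trans regA) ef => //; apply: (linked_sym regA).
  have [|w2 w2_neq0 Gw2] := direct g (S e) es_g es_f gSe.
    by rewrite SK eq_sym.
  exists (w1 * g * w2).
    have -> : e * (w1 * g * w2) * S e = (e * w1 * g) * (g * w2 * S e).
      by rewrite !mulrA -[in RHS](mulrA _ g g) gg.
    apply: (linked_mul_eq0 regA eP gP) => //.
      by rewrite !mulrA ee -!mulrA gg.
    by rewrite !mulrA gg.
  have -> : e * (w1 * g * w2) * S e = (e * w1 * g) * (g * w2 * S e).
    by rewrite !mulrA -[in RHS](mulrA _ g g) gg.
  exact: in_genM.
(* By the Peirce decomposition, one nonzero generated element in each line eAf suffices. *)
move=> x; have -> : x = \sum_(e <- es) \sum_(f <- es) e * x * f.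
  rewrite -[LHS]mul1r -[LHS]mulr1 -es_sum mulr_suml mulr_suml.
  by apply: eq_bigr => e _; rewrite mulr_sumr.
apply: in_gen_sum => e es_e; apply: in_gen_sum => f es_f.
have [eP _ _] := esP e es_e; have [fP _ _] := esP f es_f.
have [ee _ _] := eP; have [ff _ _] := fP.
have [->|exf_neq0] := eqVneq (e * x * f) 0; first exact: in_gen0.
have ef : linked e f by apply/linkedP; exists x.
have [w w_neq0 Gw] := all_links e f es_e es_f ef.
have [|c ->] := linked_span regA x eP fP _ w_neq0.
  by rewrite !mulrA ee -!mulrA ff.
exact: in_genZ.
Qed.

End Generation.

(** * The block decomposition *)

Section Blocks.
Variables (K : numClosedFieldType) (A : falgType K) (es : seq A).
Hypothesis regA : regular_alg A.
Hypothesis es_orth : orthogonal_system es.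
Hypothesis es_prim : {in es, forall e, primitive e}.
Hypothesis es_sum : \sum_(e <- es) e = 1.
Implicit Types (c e f x y : A) (B : seq A).

(** The scalar k with cxc = kc for primitive [c], taken as a coordinate so that it is total and
    linear in [x]. *)
Definition corner_coef c x : K := coord [tuple c] ord0 (c * x * c).

Lemma corner_coefE c x : primitive c -> c * x * c = corner_coef c x *: c.
Proof.
case=> _ c_neq0 cP; have [k kE] := cP x; rewrite kE /corner_coef kE linearZ /=.
by rewrite -[X in coord _ _ X]/([tuple c]`_(@ord0 0)) coord_free ?seq1_free
  ?mulr1.
Qed.

Lemma corner_coef_linear c : scalar (corner_coef c).
Proof.
by move=> k x y; rewrite /corner_coef mulrDr mulrDl -scalerAr -scalerAl linearP.
Qed.

Lemma corner_coefZ c k x : corner_coef c (k *: x) = k * corner_coef c x.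
Proof. by rewrite /corner_coef -scalerAr -scalerAl linearZ. Qed.

Lemma corner_coef_id c : primitive c -> corner_coef c c = 1.
Proof.
move=> cP; have [cc c_neq0 _] := cP.
have := corner_coefE c cP; rewrite cc cc => /eqP; rewrite -subr_eq0.
by rewrite -{1}[c]scale1r -scalerBl scaler_eq0 (negPf c_neq0) orbF subr_eq0 =>
  /eqP.
Qed.

(** A linkage class, kept as a subsequence of [es]: linked idempotents yield equal lists, so [undup]
    leaves one per class. *)
Definition block e : seq A := [seq f <- es | linked e f].
Definition blocks : seq (seq A) := undup [seq block e | e <- es].

Lemma mem_block e : e \in es -> e \in block e.
Proof. by move=> es_e; rewrite mem_filter es_e linked_refl //;
  apply: es_prim. Qed.

Lemma block_linked e f : e \in es -> f \in es -> linked e f -> block e = block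
  f.
Proof.
move=> es_e es_f ef; apply: eq_in_filter => g es_g.
have [[eP fP] gP] := (es_prim es_e, es_prim es_f, es_prim es_g).
apply/idP/idP; last exact: (linked_trans regA eP fP gP).
by apply: (linked_trans regA fP eP gP); apply: (linked_sym regA).
Qed.

Lemma blocksP B : B \in blocks ->
  B != [::] /\ {in B, forall e, e \in es /\ block e = B}.
Proof.
rewrite mem_undup => /mapP[e es_e ->]; split.
  by have := mem_block es_e; case: (block e).
move=> f; rewrite mem_filter => /andP[ef es_f]; split=> //.
by rewrite (block_linked es_e es_f ef).
Qed.

Lemma block_in_blocks e : e \in es -> block e \in blocks.
Proof. by move=> es_e; rewrite mem_undup map_f. Qed.

(** The head c of a block is its base point. The two components lie in eAc and cAe and are mutually
    inverse; products of a first with a second component within a block are its matrix units. *)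
Lemma matrix_units : {uv : A -> A * A & {in es, forall e,
  let c := head 0 (block e) in
  [/\ [/\ c \in es, e * (uv e).1 = (uv e).1 & (uv e).1 * c = (uv e).1],
      c * (uv e).2 = (uv e).2, (uv e).2 * e = (uv e).2,
      (uv e).1 * (uv e).2 = e & (uv e).2 * (uv e).1 = c]}}.
Proof.
pose R e (p : A * A) := e \in es -> let c := head 0 (block e) in
  [/\ [/\ c \in es, e * p.1 = p.1 & p.1 * c = p.1],
      c * p.2 = p.2, p.2 * e = p.2, p.1 * p.2 = e & p.2 * p.1 = c].
suff [uv uvP] : {uv : A -> A * A & forall e, R e (uv e)}.
  by exists uv => e; apply: uvP.
apply: (boolp.choice (P := R)) => e.
have [es_e|not_e] := boolP (e \in es); last by exists (0, 0) => /idPn.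
set c := head 0 (block e).
have : c \in block e.
  by rewrite /c; have := mem_block es_e; case: (block e) => // x s _;
    rewrite mem_head.
rewrite mem_filter => /andP[/linkedP[x u_neq0] es_c].
have [eP cP] := (es_prim es_e, es_prim es_c).
have [[ee _ _] [cc _ _]] := (eP, cP).
have [|v [cve uv vu]] := primitive_inv regA eP cP _ u_neq0.
  by rewrite !mulrA ee -!mulrA cc.
exists (e * x * c, v) => _ /=; rewrite -/c; split=> //.
- by split=> //; rewrite ?mulrA ?ee // -!mulrA cc.
- by rewrite -cve !mulrA cc.
- by rewrite -cve -!mulrA ee.
Qed.

Let u e := (projT1 matrix_units e).1.
Let v e := (projT1 matrix_units e).2.

Lemma unitsP e : e \in es -> let c := head 0 (block e) in
  [/\ [/\ c \in es, e * u e = u e & u e * c = u e],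
      c * v e = v e, v e * e = v e, u e * v e = e & v e * u e = c].
Proof. exact: (projT2 matrix_units). Qed.

Lemma rep_block B e : B \in blocks -> e \in B ->
  [/\ e \in es, block e = B, head 0 B \in es & primitive (head 0 B)].
Proof.
move=> /blocksP[_ BP] Be; have [es_e eB] := BP e Be.
have [[es_c _ _] _ _ _ _] := unitsP es_e.
by rewrite -eB; split=> //; apply: es_prim.
Qed.

Lemma sum_nth_block (V : nmodType) B (F : A -> V) : B != [::] ->
  \sum_(e <- B) F e = \sum_(i < (size B).-1.+1) F B`_i.
Proof. by move=> B_neq0; rewrite (big_nth 0) big_mkord; case: B B_neq0. Qed.

(** The product lies in cAc = Kc for c the head of a block [B], and the entry is that scalar. For
    non-empty [B] the dimension is [size B], written as a successor to get a matrix algebra. *)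
Definition block_mx B x : 'M[K]_((size B).-1.+1) :=
  \matrix_(j, k) corner_coef (head 0 B) (v B`_j * x * u B`_k).

Lemma block_nth B (j : 'I_(size B).-1.+1) : B \in blocks -> B`_j \in B.
Proof.
move=> /blocksP[B_neq0 _]; apply: mem_nth.
by case: (B) B_neq0 j => // ? ? _ [].
Qed.

Lemma block_uniq B : B \in blocks -> uniq B.
Proof.
rewrite mem_undup => /mapP[e _ ->]; apply: filter_uniq.
by have [] := es_orth.
Qed.

Lemma block_nth_eq B (j k : 'I_(size B).-1.+1) : B \in blocks ->
  (B`_j == B`_k) = (j == k).
Proof.
move=> BB; rewrite nth_uniq ?block_uniq //;
by have [B_neq0 _] := blocksP BB; case: (B) B_neq0 j k => // ? ? _ [? ?] [].
Qed.

Lemma unit_mul_coef B e f : B \in blocks -> e \in B -> f \in B ->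
  corner_coef (head 0 B) (v e * u f) = (e == f)%:R.
Proof.
move=> BB Be Bf; have [es_e eB es_c cP] := rep_block BB Be.
have [es_f fB _ _] := rep_block BB Bf.
have [_ _ ve _ vu] := unitsP es_e; have [[_ fu _] _ _ _ _] := unitsP es_f.
case: eqVneq => [<-|e_neq_f]; first by rewrite vu eB corner_coef_id.
rewrite -ve -fu mulrA -(mulrA (v e)); have [_ es_mul] := es_orth.
by rewrite (es_mul e f) // (negPf e_neq_f) mulr0n mulr0 mul0r /corner_coef
  mulr0 mul0r linear0.
Qed.

Lemma unit_sandwich_coef B e f x : B \in blocks -> e \in B -> f \in B ->
  v e * x * u f = corner_coef (head 0 B) (v e * x * u f) *: head 0 B.
Proof.
move=> BB Be Bf; have [es_e eB es_c cP] := rep_block BB Be.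
have [es_f fB _ _] := rep_block BB Bf.
have [_ cv _ _ _] := unitsP es_e; have [[_ _ uc] _ _ _ _] := unitsP es_f.
rewrite -corner_coefE // -{1}eB !mulrA cv -!mulrA; congr (_ * (_ * _)).
by rewrite -fB uc.
Qed.

(** Insert 1, the sum of [es], between x and y. Only members f linked to the head contribute; these
    form [B], and there f is [u f * v f]. *)
Lemma block_mx_monoid_morphism B : B \in blocks -> monoid_morphism (block_mx B).
Proof.
move=> BB; have [B_neq0 _] := blocksP BB; split.
  by apply/matrixP=> j k;
    rewrite !mxE mulr1 unit_mul_coef ?block_nth ?block_nth_eq.
move=> x y; apply/matrixP=> j k; rewrite !mxE.
have [Bj Bk] := (block_nth j BB, block_nth k BB).
have [es_j jB es_c cP] := rep_block BB Bj; have [es_k _ _ _] := rep_block BB Bk.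
set c := head 0 B.
have Bc : [seq f <- es | linked c f] = B.
  have [_ BP] := blocksP BB; have [|_ //] := BP c.
  by rewrite /c; case: (B) B_neq0 => // ? ? _; rewrite mem_head.
have -> : v B`_j * (x * y) * u B`_k =
    \sum_(f <- B) (v B`_j * x * u f) * (v f * y * u B`_k).
  have -> : v B`_j * (x * y) * u B`_k = \sum_(f <- es) v B`_j * x * f * (y * u
    B`_k).
    by rewrite -mulr_suml -mulr_sumr es_sum mulr1 !mulrA.
  rewrite (bigID (linked c)) /= [X in _ + X]big_seq_cond [X in _ + X]big1
    ?addr0 => [|f].
    rewrite -big_filter Bc; apply: eq_big_seq => f Bf.
    have [es_f _ _ _] := rep_block BB Bf; have [_ _ _ uv _] := unitsP es_f.
    by rewrite -{1}uv !mulrA.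
  case/andP=> es_f; apply: contraNeq => nz; apply/linkedP; exists (v B`_j * x).
  have [_ cv _ _ _] := unitsP es_j; rewrite jB in cv.
  by rewrite mulrA cv; apply: contraNneq nz => ->; rewrite mul0r.
rewrite {1}/corner_coef mulr_sumr mulr_suml linear_sum /= (sum_nth_block _
  B_neq0).
apply: eq_bigr => l _; rewrite !mxE -/c -/(corner_coef c _).
have Bl := block_nth l BB.
rewrite [X in corner_coef c (X * _)](unit_sandwich_coef x BB Bj Bl) -/c.
have [es_l lB _ _] := rep_block BB Bl; have [_ cv _ _ _] := unitsP es_l.
by rewrite -scalerAl corner_coefZ; rewrite lB in cv; rewrite !mulrA cv.
Qed.

Lemma block_mx_linear B : linear (block_mx B).
Proof.
move=> k x y; apply/matrixP=> i j; rewrite !mxE.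
by rewrite mulrDr mulrDl -scalerAr -scalerAl corner_coef_linear.
Qed.

Lemma block_lrmorphism B : B \in blocks ->
  {phi : {lrmorphism A -> 'M[K]_((size B).-1.+1)} | phi =1 block_mx B}.
Proof.
move=> BB.
pose phi : {lrmorphism A -> 'M[K]_((size B).-1.+1)} := HB.pack (block_mx B)
  (GRing.isLinear.Build K A _ _ (block_mx B) (@block_mx_linear B))
  (GRing.isMonoidMorphism.Build A _ (block_mx B) (block_mx_monoid_morphism BB)).
by exists phi.
Qed.

(** If [B] and [B'] differ, both sides are zero, as distinct blocks share no idempotent. *)
Lemma block_mx_units B B' (i j : 'I_(size B).-1.+1) e f :
  B \in blocks -> B' \in blocks -> e \in B' -> f \in B' ->
  block_mx B (u e * v f) i j = ((B`_i == e) && (f == B`_j))%:R.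
Proof.
move=> BB BB' Be Bf; rewrite mxE.
have [es_e eB _ _] := rep_block BB' Be; have [es_f fB _ _] := rep_block BB' Bf.
have [Bi Bj] := (block_nth i BB, block_nth j BB).
have [es_i iB es_c cP] := rep_block BB Bi;
  have [es_j jB _ _] := rep_block BB Bj.
have [[_ eu _] _ _ _ _] := unitsP es_e; have [_ _ vf _ _] := unitsP es_f.
have [_ _ vi _ vu] := unitsP es_i; have [[_ ju _] _ _ _ vuj] := unitsP es_j.
have [_ es_mul] := es_orth.
have [ie|i_neq] := eqVneq B`_i e; last first.
  rewrite -vi -eu !mulrA -(mulrA (v _)) (es_mul B`_i e) // (negPf i_neq) mulr0n.
  by rewrite mulr0 !mul0r /corner_coef mulr0 mul0r linear0.
have [fj|j_neq] := eqVneq f B`_j; last first.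
  rewrite -vf -ju -!mulrA (mulrA f) (es_mul f B`_j) // (negPf j_neq) mulr0n.
  by rewrite mul0r !mulr0 /corner_coef mulr0 mul0r linear0.
have [cc _ _] := cP.
by rewrite -ie fj !mulrA vu -mulrA vuj iB jB cc corner_coef_id.
Qed.

Lemma sum_corners x : x = \sum_(e <- es) \sum_(f <- es) e * x * f.
Proof.
rewrite -[LHS]mul1r -[LHS]mulr1 -es_sum mulr_suml mulr_suml.
by apply: eq_bigr => e _; rewrite mulr_sumr.
Qed.

(** A nonzero exf has e and f in one block, and is recovered from the matrix entry [v e * x * u f]
    by multiplying with [u e] and [v f]. *)
Lemma block_mx_inj x : {in blocks, forall B, block_mx B x = 0} -> x = 0.
Proof.
move=> x0; rewrite (sum_corners x) big_seq big1 // => e es_e.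
rewrite big_seq big1 // => f es_f.
have [//|exf_neq0] := eqVneq (e * x * f) 0.
have ef : linked e f by apply/linkedP; exists x.
have BB := block_in_blocks es_e.
have Be := mem_block es_e.
have Bf : f \in block e by rewrite mem_filter ef.
have [_ _ _ uve _] := unitsP es_e; have [_ _ _ uvf _] := unitsP es_f.
suff: v e * x * u f = 0.
  move=> vxu; rewrite -uve -uvf -!mulrA (mulrA x) (mulrA (v e)) (mulrA (v e)).
  by rewrite vxu mul0r mulr0.
rewrite (unit_sandwich_coef x BB Be Bf).
have lt_index g : g \in block e -> (index g (block e) < (size (block
  e)).-1.+1)%N.
  by rewrite -index_mem; case: (block e).
have := congr1 (fun M : 'M_(_) => M (Ordinal (lt_index e Be)) (Ordinal
  (lt_index f Bf)))
  (x0 _ BB).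
by rewrite !mxE /= !nth_index // => ->; rewrite scale0r.
Qed.

(** The inverse map sends a family of matrices to the corresponding combination of matrix units.
    Sizes are given as counts so that a 2 x 2 summand can be recognized from the idempotents. *)
Lemma wedderburn_blocks : exists (r : nat) (n : 'I_r -> nat)
    (phi : forall i : 'I_r, {lrmorphism A -> 'M[K]_((n i).+1)}),
  matrix_decomposition phi /\
  {in es, forall e, exists i, (n i).+1 = count (linked e) es}.
Proof.
pose B (i : 'I_(size blocks)) := nth [::] blocks i.
have BB i : B i \in blocks by apply: mem_nth.
exists (size blocks), (fun i => (size (B i)).-1), (fun i => sval
  (block_lrmorphism (BB i))).
split; last first.
  move=> e es_e; have be := block_in_blocks es_e.
  have lt_i : (index (block e) blocks < size blocks)%N by rewrite index_mem.
  exists (Ordinal lt_i); rewrite /B /= nth_index // -size_filter -/(block e).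
  by have := mem_block es_e; rewrite /block; case: filter.
rewrite /matrix_decomposition; set F := (X in bijective X).
pose G (M : {dffun forall i, 'M[K]_((size (B i)).-1.+1)}) : A :=
  \sum_i \sum_j \sum_k M i j k *: (u (B i)`_j * v (B i)`_k).
have phiE i x : sval (block_lrmorphism (BB i)) x = block_mx (B i) x.
  by case: block_lrmorphism.
have F_inj : injective F.
  move=> x y /ffunP Fxy; apply/eqP; rewrite -subr_eq0; apply/eqP.
  apply: block_mx_inj => b bb.
  have lt_b : (index b blocks < size blocks)%N by rewrite index_mem.
  have bE : B (Ordinal lt_b) = b by rewrite /B /= nth_index.
  rewrite -bE -phiE linearB /=; have := Fxy (Ordinal lt_b).
  by rewrite !ffunE => ->; rewrite subrr.
have GK : cancel G F.
  move=> M; apply/ffunP=> i; rewrite ffunE /G linear_sum /=.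
  apply/matrixP=> j k; rewrite summxE.
  have entry i0 : sval (block_lrmorphism (BB i))
      (\sum_j0 \sum_k0 M i0 j0 k0 *: (u (B i0)`_j0 * v (B i0)`_k0)) j k =
    \sum_j0 \sum_k0 M i0 j0 k0 *
      (((B i)`_j == (B i0)`_j0) && ((B i0)`_k0 == (B i)`_k))%:R.
    rewrite linear_sum summxE; apply: eq_bigr => j0 _.
    rewrite linear_sum summxE; apply: eq_bigr => k0 _.
    by rewrite linearZ mxE /= phiE (block_mx_units _ _ (BB i) (BB i0))
      ?block_nth.
  rewrite (bigD1 i) //= entry (bigD1 j) //= (bigD1 k) //= !eqxx mulr1.
  rewrite !big1 ?addr0 // => [i0 i0_neq|j0 j0_neq|k0 k0_neq]; last first.
  - by rewrite block_nth_eq // (negPf k0_neq) mulr0.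
  - by rewrite big1 // => k0 _;
      rewrite block_nth_eq // eq_sym (negPf j0_neq) mulr0.
  rewrite entry big1 // => j0 _; rewrite big1 // => k0 _.
  suff /negPf-> : (B i)`_j != (B i0)`_j0 by rewrite mulr0.
  apply: contraNneq i0_neq => eqB.
  have [_ eBi _ _] := rep_block (BB i) (block_nth j (BB i)).
  have [_ eBi0 _ _] := rep_block (BB i0) (block_nth j0 (BB i0)).
  have : B i0 = B i by rewrite -eBi -eBi0 eqB.
  by move/eqP; rewrite nth_uniq ?undup_uniq.
exists G => //; exact: inj_can_sym.
Qed.

End Blocks.

(** * Deducing the third linked idempotent from the absence of 2 x 2 summands *)

Theorem exists_generating_pair (K : numClosedFieldType) (A : falgType K)
    (S : {linear A -> A}) :
  semisimple_alg A -> alg_anti_automorphism S -> involutive S ->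
  no_M2_summand A -> exists a : A, generates_alg [:: a; S a].
Proof.
move=> ssA [_ SM] SK noM2; have regA := semisimple_regular ssA.
have [es [es_orth esP es_sum]] :=
  adapted_system regA SM SK (mulr1 1) (anti_inv1 SM SK).
have es_prim : {in es, forall e, primitive e} by move=> e /esP[].
apply: (generates_of_third_link regA SM SK es_orth esP es_sum) => e es_e Se_neq
  eSe.
have [//|noF] :=
  pselect (exists f, [/\ f \in es, linked e f, f != e & f != S e]).
have [r [n [phi [phi_dec phi_dim]]]] := wedderburn_blocks regA es_orth es_prim
  es_sum.
have [i n_i] := phi_dim e es_e; have := noM2 r n phi phi_dec i; rewrite n_i.
(* Without a third idempotent the class of [e] is {e, Se}, so its matrix summand has size 2, which
   is excluded. *)
suff -> : count (linked e) es = 2%N by [].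
have [es_uniq _] := es_orth; have [eP _ es_Se] := esP e es_e.
rewrite -size_filter; rewrite (perm_size (_ : perm_eq _ [:: e; S e])) //.
apply: uniq_perm; rewrite ?filter_uniq //= ?inE ?andbT; first by rewrite eq_sym.
move=> f; rewrite mem_filter !inE.
apply/andP/orP => [[ef es_f]|[]/eqP->]; last 2 first.
- by split=> //; apply: linked_refl.
- by split.
have [fe|f_neq_e] := eqVneq f e; [by left | right].
by apply: contra_notT noF => f_neq; exists f.
Qed.

Local Open Scope complex_scope.

Theorem theorem1 (R : realType) (A : falgType R[i]) (S : {linear A -> A}) :
  semisimple_alg A ->
  alg_anti_automorphism S ->
  involutive S ->
  no_M2_summand A ->
  exists a : A, generates_alg [:: a; S a].
Proof. exact: exists_generating_pair. Qed.
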